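(* There is an absolute constant $C>0$ such that the following holds. Let $B>0$, let $d,h\ge 1$ be integers, and let $n=n_0,n_1,\dots,n_{d-1},n_d=k$ be positive integers with $k\ge 2$ and $n_i\le h$ for all $0\le i\le d$. For parameters $w=\mathrm{vec}(\{W_i\}_{i=1}^d)$ with $W_i\in\mathbb{R}^{n_i\times n_{i-1}}$, let $f_w:\mathcal{X}_{B,n}\to\mathbb{R}^k$ be the $d$-layer feedforward network with ReLU activations, $f_w(x)=W_d\,\phi(W_{d-1}\,\phi(\cdots\phi(W_1x)))$. Let $\mathcal{D}$ be any probability distribution on $\mathcal{X}_{B,n}\times\{1,\dots,k\}$. Then for any $\delta,\gamma>0$, with probability at least $1-\delta$ over a training set of $m$ i.i.d. samples from $\mathcal{D}$, for all $w$ (with every $W_i\neq 0$) simultaneously, $$L_0(f_w)\le \widehat{L}_\gamma(f_w)+C\sqrt{\frac{\frac{1}{\gamma^2}\,B^2d^2h\ln(dh)\,\prod_{i=1}^d\|W_i\|_2^2\,\sum_{i=1}^d\frac{\|W_i\|_F^2}{\|W_i\|_2^2}+\ln\frac{dm}{\delta}}{m}}.$$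
   Context: $\mathcal{X}_{B,n}=\{x\in\mathbb{R}^n : \sum_{i=1}^n x_i^2\le B^2\}$. $\phi(t)=\max(t,0)$ is the ReLU function, applied coordinatewise (for $d=1$, $f_w(x)=W_1x$). $\|\cdot\|_F$ is the Frobenius norm and $\|\cdot\|_2$ the spectral (operator) norm of a matrix. For $\gamma\ge 0$ the expected margin loss is $$L_\gamma(f_w)=\mathbb{P}_{(x,y)\sim\mathcal{D}}\Big[f_w(x)[y]\le\gamma+\max_{j\ne y}f_w(x)[j]\Big],$$ where $f_w(x)[j]$ is the $j$-th coordinate of $f_w(x)$; $\widehat{L}_\gamma(f_w)$ is its empirical estimate, i.e. the fraction of the $m$ training samples $(x,y)$ satisfying the same inequality. $L_0$ is the expected classification risk. The number $h$ is an upper bound on the dimensions of all weight matrices. *)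

(* Defs.v *)
From HB Require Import structures.
From mathcomp Require Import all_boot all_order all_algebra.
From mathcomp Require Import all_classical all_reals all_analysis.

Set Implicit Arguments.
Unset Strict Implicit.
Unset Printing Implicit Defensive.

Import Order.TTheory GRing.Theory Num.Theory.

Local Open Scope classical_set_scope.
Local Open Scope ring_scope.

Definition norm2 (R : realType) (n : nat) (x : 'cV[R]_n) : R :=
  Num.sqrt (\sum_i x i 0 ^+ 2).

Definition frobenius_norm (R : realType) (m n : nat) (A : 'M[R]_(m, n)) : R :=
  Num.sqrt (\sum_i \sum_j A i j ^+ 2).

Definition spectral_norm (R : realType) (m n : nat) (A : 'M[R]_(m, n)) : R :=
  sup [set norm2 (A *m x) | x in [set x : 'cV[R]_n | norm2 x <= 1]].

Definition input_ball (R : realType) (n : nat) (B : R) : Type :=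
  {x : 'cV[R]_n | \sum_i x i 0 ^+ 2 <= B ^+ 2}.

Section input_ball_measurable.
Variables (R : realType) (n : nat) (B : R).

Lemma zero_in_ball : \sum_i (0 : 'cV[R]_n) i 0 ^+ 2 <= B ^+ 2.
Proof. by rewrite big1 ?sqr_ge0// => i _; rewrite mxE expr0n. Qed.

HB.instance Definition _ := Choice.on (input_ball n B).
HB.instance Definition _ := isPointed.Build (input_ball n B)
  (exist (fun x : 'cV[R]_n => \sum_i x i 0 ^+ 2 <= B ^+ 2) 0 zero_in_ball).

Definition ball_coords (x : input_ball n B) : n.-tuple R :=
  [tuple sval x i 0 | i < n].

(* The trace on the ball of the Borel sigma-algebra of R^n. *)
HB.instance Definition _ :=
  Measurable.copy (input_ball n B) (g_sigma_algebra_preimageType ball_coords).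

End input_ball_measurable.

(* Measurable types are pointed, so the set of labels {0, .., k-1} carries a
   proof that it is not empty. *)
Definition label (k : nat) (k_gt1 : (1 < k)%N) : Type := 'I_k.

Section label_measurable.
Variables (k : nat) (k_gt1 : (1 < k)%N).

HB.instance Definition _ := Finite.on (label k_gt1).
HB.instance Definition _ :=
  isPointed.Build (label k_gt1) (Ordinal (ltnW k_gt1)).
HB.instance Definition _ := @isMeasurable.Build default_measure_display
  (label k_gt1) discrete_measurable discrete_measurable0
  discrete_measurableC discrete_measurableU.

End label_measurable.

Definition relu (R : realType) (n : nat) (x : 'cV[R]_n) : 'cV[R]_n :=
  map_mx (fun t => Num.max t 0) x.

(* Layer widths are n 0, .., n d (the values of n beyond d play no role), and
   W i is the matrix W_(i+1) from layer i to layer i+1.  The ReLU is applied to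
   the output of every layer except the last; the input itself (i = 0) is not
   rectified. *)
Fixpoint network (R : realType) (n : nat -> nat) (d : nat) :
    (forall i : 'I_d, 'M[R]_(n i.+1, n i)) -> 'cV[R]_(n 0) -> 'cV[R]_(n d) :=
  match d with
  | 0 => fun _ x => x
  | d'.+1 => fun W x =>
      let z := network (fun i : 'I_d' => W (widen_ord (leqnSn d') i)) x in
      W ord_max *m (if d' == 0%N then z else relu z)
  end.

(* f(x)[y] <= gamma + max_(j != y) f(x)[j], the maximum being computed in the
   extended reals. *)
Definition margin_violation (R : realType) (n k : nat) (B : R)
    (k_gt1 : (1 < k)%N) (f : 'cV[R]_n -> 'cV[R]_k) (gamma : R)
    (xy : input_ball n B * label k_gt1) : bool :=
  let z := f (sval xy.1) in let y : 'I_k := xy.2 in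
  ((z y 0)%:E <= gamma%:E + \big[maxe/-oo]_(j < k | j != y) (z j 0)%:E)%E.

Definition margin_loss (R : realType) (n k : nat) (B : R)
    (k_gt1 : (1 < k)%N) (D : probability (input_ball n B * label k_gt1)%type R)
    (gamma : R) (f : 'cV[R]_n -> 'cV[R]_k) : R :=
  fine (D [set xy | margin_violation f gamma xy]).

Definition empirical_margin_loss (R : realType) (n k : nat) (B : R)
    (k_gt1 : (1 < k)%N) (m : nat) (s : 'I_m -> input_ball n B * label k_gt1)
    (gamma : R) (f : 'cV[R]_n -> 'cV[R]_k) : R :=
  (\sum_(i < m) margin_violation f gamma (s i))%:R / m%:R.

Definition mutually_independent (R : realType) (d d' : measure_display)
    (Omega : measurableType d) (T : measurableType d') (P : probability Omega R)
    (m : nat) (S : 'I_m -> {RV P >-> T}) : Prop :=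
  forall (J : {set 'I_m}) (A : 'I_m -> set T),
    (forall i, measurable (A i)) ->
    P (\bigcap_(i in [set` J]) (S i @^-1` A i)) =
    (\prod_(i in J) P (S i @^-1` A i))%E.

Definition iid (R : realType) (d d' : measure_display)
    (Omega : measurableType d) (T : measurableType d') (P : probability Omega R)
    (D : probability T R) (m : nat) (S : 'I_m -> {RV P >-> T}) : Prop :=
  mutually_independent S /\
  forall i (A : set T), measurable A -> distribution P (S i) A = D A.

(* Main.v *)
(* Instead of a PAC-Bayes argument with Gaussian perturbations, cover the class
   by finitely many networks and take a union bound.

   Rescale the layers to spectral norm 1, which multiplies the network by
   [1 / prod_i ||W_i||].  If a matrix [M] has spectral norm above [eps], some
   dyad [u v^T] with [u], [v] in a grid of at most [(16 h + 1)^(h + 1)] points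
   has inner product at least [eps / 2] with [M], and subtracting a small
   multiple of it decreases [||M||_F^2] by [eps^2 / 8].  Hence all layers are
   approximated within [eps] in spectral norm by words of length
   [T ~ sum_i ||W_i||_F^2 / (||W_i||_2^2 eps^2)] over an alphabet of size
   [(d h)^O(h)], whose letters are a layer index and two grid vectors.

   With [eps] of order [gamma / (d B prod_i ||W_i||)] the outputs of the two
   networks differ by less than a quarter of the (rescaled) margin, so the
   Chernoff bound for the margin loss of the words transfers to all networks;
   the union over [1 / eps] and [T] up to [m] costs the term [ln (m / delta)].
   When [1 / eps] or [T] exceeds [m], the claimed bound exceeds 1. *)
From HB Require Import structures.
Require Import Defs.
From mathcomp Require Import all_boot all_order all_algebra.
From mathcomp Require Import all_classical all_reals all_analysis.
From mathcomp Require Import measurable_realfun ring lra zify.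

Set Implicit Arguments.
Unset Strict Implicit.
Unset Printing Implicit Defensive.

Import Order.TTheory GRing.Theory Num.Theory.

Local Open Scope classical_set_scope.
Local Open Scope ring_scope.

(** * Concentration of empirical frequencies *)

Lemma probability_bigsetU_le (R : realType) (d : measure_display)
    (T : measurableType d) (P : probability T R) (I : Type) (r : seq I)
    (Q : pred I) (F : I -> set T) :
  (forall i, measurable (F i)) ->
  (P (\big[setU/set0]_(i <- r | Q i) F i) <= \sum_(i <- r | Q i) P (F i))%E.
Proof.
move=> mF.
have [] // : measurable (\big[setU/set0]_(i <- r | Q i) F i) /\
  (P (\big[setU/set0]_(i <- r | Q i) F i) <= \sum_(i <- r | Q i) P (F i))%E.
apply: (big_rec2 (fun x y => measurable x /\ (P x <= y)%E)).
  by rewrite measure0; split.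
move=> i x y _ [mx xy]; split; first exact: measurableU.
by apply: (le_trans (measureU2 _ _ _)) => //; exact: leeD2l.
Qed.

(** Since (1 + lam)(1 - lam + lam^2) = 1 + lam^3 >= 1 and exp lam >= 1 + lam, exp (- lam) is at most
    1 - lam + lam^2; the rest is 1 + x <= exp x. *)
Lemma bernoulli_mgf_le (R : realType) (p lam : R) : 0 <= p <= 1 -> 0 <= lam ->
  p * expR (- lam) + (1 - p) <= expR (- (lam * p) + lam ^+ 2).
Proof.
move=> /andP[p0 p1] l0.
have e1 : expR (- lam) <= 1 - lam + lam ^+ 2.
  rewrite expRN -[leLHS]mul1r ler_pdivrMr ?expR_gt0//.
  have := expR_ge1Dx lam.
  have : 0 < 1 - lam + lam ^+ 2 by nra.
  nra.
apply: (le_trans _ (expR_ge1Dx _)).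
have : p * expR (- lam) <= p * (1 - lam + lam ^+ 2) by exact: ler_wpM2l.
nra.
Qed.

(** Chernoff's argument on the finitely many hit patterns in {0,1}^m: independence makes the
    probability of a pattern a product, so the exponential Markov inequality is a finite sum and no
    integral is formed. *)
Lemma iid_lower_tail (R : realType) (d d' : measure_display)
    (Omega : measurableType d) (T : measurableType d') (P : probability Omega R)
    (D : probability T R) (m : nat) (S : 'I_m -> {RV P >-> T}) (A : set T)
    (t : R) :
  iid D S -> measurable A -> (0 < m)%N -> 0 <= t ->
  exists Bad : set Omega,
    [/\ measurable Bad,
        (P Bad <= (expR (- (m%:R * t ^+ 2 / 4)))%:E)%E &
        forall w, ~ Bad w ->
          fine (D A) <= (\sum_(i < m) (`[< A (S i w) >] : nat))%:R / m%:R + t].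
Proof.
move=> [indep distr] mA m0 t0.
set p := fine (D A).
have DA : D A = p%:E by rewrite fineK// fin_num_measure.
have p01 : 0 <= p <= 1.
  by rewrite -!lee_fin -DA measure_ge0 probability_le1.
pose AA (b : {ffun 'I_m -> bool}) i := if b i then A else ~` A.
pose cyl b := \bigcap_(i in [set` [set: 'I_m]%SET]) (S i @^-1` AA b i).
have mAA b i : measurable (AA b i).
  by rewrite /AA; case: (b i) => //; exact: measurableC.
have mcyl b : measurable (cyl b).
  apply: fin_bigcap_measurable => // i _.
  by rewrite -[X in measurable X]setTI; exact: measurable_funPT.
pose w (b : bool) : R := if b then p else 1 - p.
have Pcyl b : P (cyl b) = (\prod_(i < m) w (b i))%:E.
  rewrite indep// -prodEFin; apply: eq_big => [i|i _]; first by rewrite inE.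
  have -> : P (S i @^-1` AA b i) = distribution P (S i) (AA b i) by [].
  rewrite distr// /AA /w; case: (b i) => //.
  by rewrite probability_setC// DA.
pose cnt (b : {ffun 'I_m -> bool}) : nat := (\sum_(i < m) b i)%N.
pose bad b := (cnt b)%:R / m%:R + t < p.
exists (\big[setU/set0]_(b | bad b) cyl b); split.
- by apply: bigsetU_measurable.
- apply: (le_trans (probability_bigsetU_le _ _ _ _)) => //.
  under eq_bigr do rewrite Pcyl.
  rewrite sumEFin lee_fin.
  have mR : 0 < m%:R :> R by rewrite ltr0n.
  (* This minimizes lam^2 - lam t; the exponent becomes -m t^2 / 4. *)
  pose lam := t / 2.
  have lam0 : 0 <= lam by rewrite divr_ge0.
  have w0 b : 0 <= w b by rewrite /w; case: b; lra.
  (* On a bad pattern [cnt b] is below m (p - t), so the exponential factor is at least 1; the sum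
     is then extended to all patterns. *)
  apply: (@le_trans _ _ (\sum_(b : {ffun 'I_m -> bool})
     expR (lam * (m%:R * (p - t))) *
       \prod_(i < m) (w (b i) * expR (- lam * (b i)%:R)))).
    rewrite [leRHS](bigID bad)/= -[leLHS]addr0 lerD//; last first.
      apply: sumr_ge0 => b _; rewrite mulr_ge0 ?expR_ge0// prodr_ge0// => i _.
      by rewrite mulr_ge0 ?expR_ge0.
    apply: ler_sum => b Hb.
    rewrite big_split/= mulrCA -[leLHS]mulr1 ler_wpM2l ?prodr_ge0//.
    rewrite -expR_sum -expRD -[leLHS]expR0 ler_expR -mulr_sumr -natr_sum.
    rewrite mulNr -mulrBr mulr_ge0// subr_ge0.
    move: Hb; rewrite /bad -ltrBrDr ltr_pdivrMr// => /ltW.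
    by rewrite mulrC.
  (* By distributivity the sum over patterns is the m-th power of one Bernoulli generating
     function. *)
  rewrite -mulr_sumr -(bigA_distr_bigA (fun _ c => w c * expR (- lam * c%:R))).
  under eq_bigr do rewrite big_bool/= mulr1 mulr0 expR0 mulr1.
  rewrite prodr_const card_ord.
  apply: (@le_trans _ _ (expR (lam * (m%:R * (p - t))) *
                         expR (- (lam * p) + lam ^+ 2) ^+ m)).
    rewrite ler_wpM2l ?expR_ge0// lerXn2r ?nnegrE ?expR_ge0//.
      by rewrite addr_ge0// ?mulr_ge0// ?expR_ge0//; lra.
    exact: bernoulli_mgf_le.
  rewrite -expRM_natl -expRD ler_expR /lam -mulr_natl.
  by rewrite [leLHS](_ : _ = - (m%:R * t ^+ 2 / 4))//; field.
- move=> om nB; rewrite leNgt; apply/negP => H; apply: nB.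
  pose b := [ffun i => `[< A (S i om) >]].
  have badb : bad b.
    by rewrite /bad /cnt; under eq_bigr do rewrite ffunE.
  rewrite (bigD1 b)//=; left => i _ /=.
  by rewrite /AA ffunE; case: asboolP.
Qed.

(** * Euclidean, Frobenius and spectral norms *)

Lemma cauchy_schwarz_sum (R : realType) (I : finType) (x y : I -> R) :
  (\sum_i x i * y i) ^+ 2 <= (\sum_i x i ^+ 2) * (\sum_i y i ^+ 2).
Proof.
set a := \sum_i x i ^+ 2; set b := \sum_i x i * y i; set c := \sum_i y i ^+ 2.
have a0 : 0 <= a by apply: sumr_ge0 => i _; exact: sqr_ge0.
(* Expanding gives a (a c - b^2), which settles a > 0; if a = 0, every x_i vanishes. *)
have : 0 <= \sum_i (a * y i - b * x i) ^+ 2.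
  by apply: sumr_ge0 => i _; exact: sqr_ge0.
have -> : \sum_i (a * y i - b * x i) ^+ 2 = a * (a * c - b ^+ 2).
  rewrite (eq_bigr (fun i => a ^+ 2 * y i ^+ 2
    + (- (2 * a * b) * (x i * y i) + b ^+ 2 * x i ^+ 2))) => [|i _]; last by ring.
  rewrite !big_split/= -!mulr_sumr -/a -/b -/c; ring.
move: a0; rewrite le_eqVlt => /orP[/eqP a0 _|a0]; last first.
  by rewrite pmulr_rge0// subr_ge0.
have -> : b = 0.
  rewrite /b big1// => i _; apply/eqP; rewrite mulf_eq0; apply/orP; left.
  rewrite -sqrf_eq0; move/esym/eqP: a0; rewrite psumr_eq0 => [|j _].
    by move/allP/(_ i (mem_index_enum _)).
  exact: sqr_ge0.
by rewrite expr0n/= -a0 mul0r.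
Qed.

Section euclidean_norm.
Variable R : realType.
Implicit Types n p : nat.

Lemma norm2_ge0 n (x : 'cV[R]_n) : 0 <= norm2 x.
Proof. exact: sqrtr_ge0. Qed.

Lemma sqr_norm2 n (x : 'cV[R]_n) : norm2 x ^+ 2 = \sum_i x i 0 ^+ 2.
Proof. by rewrite sqr_sqrtr// sumr_ge0// => i _; exact: sqr_ge0. Qed.

Lemma norm2_le n (x : 'cV[R]_n) (c : R) :
  0 <= c -> \sum_i x i 0 ^+ 2 <= c ^+ 2 -> norm2 x <= c.
Proof. by move=> c0 xc; rewrite -(ler_pXn2r (n:=2))// ?nnegrE ?norm2_ge0// sqr_norm2. Qed.

Lemma dot_le n (x y : 'cV[R]_n) :
  \sum_i x i 0 * y i 0 <= norm2 x * norm2 y.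
Proof.
apply: (le_trans (ler_norm _)).
rewrite -(ler_pXn2r (n:=2))// ?nnegrE ?mulr_ge0 ?norm2_ge0//.
by rewrite real_normK ?num_real// exprMn !sqr_norm2; exact: cauchy_schwarz_sum.
Qed.

Lemma norm2_eq0 n (x : 'cV[R]_n) : norm2 x = 0 -> x = 0.
Proof.
move=> x0; have := sqr_norm2 x; rewrite x0 expr0n/= => /esym/eqP.
rewrite psumr_eq0 => [/allP H|i _]; last exact: sqr_ge0.
apply/colP => i; rewrite mxE; apply/eqP; rewrite -sqrf_eq0.
exact: H (mem_index_enum _).
Qed.

Lemma norm2_0 n : norm2 (0 : 'cV[R]_n) = 0.
Proof. by rewrite /norm2 big1 ?sqrtr0// => i _; rewrite mxE expr0n. Qed.

Lemma norm2D n (x y : 'cV[R]_n) : norm2 (x + y) <= norm2 x + norm2 y.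
Proof.
apply: norm2_le; first by rewrite addr_ge0 ?norm2_ge0.
rewrite (eq_bigr (fun i => x i 0 ^+ 2 + (y i 0 ^+ 2 + 2 * (x i 0 * y i 0))))
  => [|i _]; last by rewrite mxE; ring.
rewrite !big_split/= -!sqr_norm2 -mulr_sumr.
have := dot_le x y; lra.
Qed.

Lemma norm2Z n (a : R) (x : 'cV[R]_n) : norm2 (a *: x) = `|a| * norm2 x.
Proof.
rewrite /norm2; under eq_bigr do rewrite mxE exprMn.
by rewrite -mulr_sumr sqrtrM ?sqr_ge0// sqrtr_sqr.
Qed.

Lemma le_norm2 n (x y : 'cV[R]_n) :
  (forall i, `|x i 0| <= `|y i 0|) -> norm2 x <= norm2 y.
Proof.
move=> xy; rewrite ler_wsqrtr// ler_sum// => i _.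
rewrite -[leLHS]real_normK ?num_real// -[leRHS]real_normK ?num_real//.
by rewrite lerXn2r ?nnegrE.
Qed.

Lemma norm2_coord n (x : 'cV[R]_n) i : `|x i 0| <= norm2 x.
Proof.
rewrite -sqrtr_sqr ler_wsqrtr// (bigD1 i)//= lerDl sumr_ge0// => j _.
exact: sqr_ge0.
Qed.

Lemma norm2_relu n (x : 'cV[R]_n) : norm2 (relu x) <= norm2 x.
Proof.
by apply: le_norm2 => i; rewrite mxE; case: (leP (x i 0) 0); rewrite ?normr0.
Qed.

Lemma norm2_relu_sub n (x y : 'cV[R]_n) :
  norm2 (relu x - relu y) <= norm2 (x - y).
Proof.
apply: le_norm2 => i; rewrite !mxE.
case: (leP (x i 0) 0) => hx; case: (leP (y i 0) 0) => hy;
  rewrite ler_norml; have [] := ler0P (x i 0 - y i 0); lra.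
Qed.

Lemma reluZ n (a : R) (x : 'cV[R]_n) : 0 <= a -> relu (a *: x) = a *: relu x.
Proof. by move=> a0; apply/colP => i; rewrite !mxE maxr_pMr// mulr0. Qed.

Lemma sqr_frobenius_norm n p (A : 'M[R]_(n, p)) :
  frobenius_norm A ^+ 2 = \sum_i \sum_j A i j ^+ 2.
Proof.
by rewrite sqr_sqrtr// sumr_ge0// => i _; rewrite sumr_ge0// => j _; exact: sqr_ge0.
Qed.

Lemma frobenius_norm_ge0 n p (A : 'M[R]_(n, p)) : 0 <= frobenius_norm A.
Proof. exact: sqrtr_ge0. Qed.

Lemma norm2_mulmx_frobenius n p (A : 'M[R]_(n, p)) (x : 'cV[R]_p) :
  norm2 (A *m x) <= frobenius_norm A * norm2 x.
Proof.
apply: norm2_le; first by rewrite mulr_ge0 ?norm2_ge0 ?frobenius_norm_ge0.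
rewrite exprMn sqr_frobenius_norm mulr_suml ler_sum// => i _.
by rewrite mxE sqr_norm2; exact: cauchy_schwarz_sum.
Qed.

(** The Frobenius norm is an upper bound. This keeps [sup] away from its default value 0 on
    unbounded sets. *)
Lemma spectral_set_has_sup n p (A : 'M[R]_(n, p)) :
  has_sup [set norm2 (A *m x) | x in [set x : 'cV[R]_p | norm2 x <= 1]].
Proof.
split; first by exists (norm2 (A *m 0)), 0 => //=; rewrite norm2_0.
exists (frobenius_norm A) => _ [x /= x1 <-].
by rewrite (le_trans (norm2_mulmx_frobenius _ _))// ler_piMr ?frobenius_norm_ge0.
Qed.

Lemma spectral_norm_le_frobenius n p (A : 'M[R]_(n, p)) :
  spectral_norm A <= frobenius_norm A.
Proof.
apply: ge_sup; first by have [] := spectral_set_has_sup A.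
move=> _ [x /= x1 <-].
by rewrite (le_trans (norm2_mulmx_frobenius _ _))// ler_piMr ?frobenius_norm_ge0.
Qed.

Lemma norm2_mulmx_le n p (A : 'M[R]_(n, p)) (x : 'cV[R]_p) :
  norm2 (A *m x) <= spectral_norm A * norm2 x.
Proof.
have := norm2_ge0 x; rewrite le_eqVlt => /orP[/eqP/esym x0|x0].
  by rewrite x0 mulr0 (norm2_eq0 x0) mulmx0 norm2_0.
rewrite -ler_pdivrMr// mulrC -{1}(gtr0_norm x0) -normfV -norm2Z scalemxAr.
apply: ub_le_sup; first by have [] := spectral_set_has_sup A.
by exists ((norm2 x)^-1 *: x) => //=; rewrite norm2Z normfV gtr0_norm// mulVf// gt_eqF.
Qed.

Lemma spectral_norm_ge0 n p (A : 'M[R]_(n, p)) : 0 <= spectral_norm A.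
Proof.
rewrite -(norm2_0 n) -(mulmx0 _ A); apply: ub_le_sup.
  by have [] := spectral_set_has_sup A.
by exists 0 => //=; rewrite norm2_0.
Qed.

Lemma spectral_norm_gt0 n p (A : 'M[R]_(n, p)) : A != 0 -> 0 < spectral_norm A.
Proof.
move=> A0; rewrite lt_neqAle spectral_norm_ge0 andbT eq_sym.
apply: contra A0 => /eqP A0; apply/eqP/matrixP => i j.
have := norm2_mulmx_le A (delta_mx j 0); rewrite A0 mul0r => le0.
have /norm2_eq0 : norm2 (A *m delta_mx j 0) = 0.
  by apply/eqP; rewrite eq_le le0 norm2_ge0.
by rewrite -colE => /colP/(_ i); rewrite !mxE.
Qed.

(** A near-maximizer takes the place of a top singular vector. *)
Lemma spectral_norm_approx n p (A : 'M[R]_(n, p)) (c : R) :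
  c < spectral_norm A -> exists2 x : 'cV[R]_p, norm2 x <= 1 & c < norm2 (A *m x).
Proof.
move=> cA.
have [|_ [x /= x1 <-]] :=
    @sup_adherent _ _ (spectral_norm A - c) _ (spectral_set_has_sup A).
  by rewrite subr_gt0.
by rewrite subKr => ?; exists x.
Qed.

End euclidean_norm.

(** * Scaling and perturbation of network weights *)

Section network_perturbation.
Variables (R : realType) (n : nat -> nat).

Lemma networkS d (W : forall i : 'I_d.+1, 'M[R]_(n i.+1, n i)) x :
  network W x =
  W ord_max *m (if d == 0%N then network (fun i => W (widen_ord (leqnSn d) i)) x
                else relu (network (fun i => W (widen_ord (leqnSn d) i)) x)).
Proof. by []. Qed.

(** Nonnegative factors pass through the ReLU by positive homogeneity. *)
Lemma network_scale d (W : forall i : 'I_d, 'M[R]_(n i.+1, n i)) (c : 'I_d -> R) x :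
  (forall i, 0 <= c i) ->
  network (fun i => c i *: W i) x = (\prod_i c i) *: network W x.
Proof.
elim: d W c => [|d IH] W c c0; first by rewrite big_ord0 scale1r.
rewrite !networkS IH// big_ord_recr/=.
set z := network _ x.
have p0 : 0 <= \prod_(i < d) c (widen_ord (leqnSn d) i) by exact: prodr_ge0.
case: ifP => _; rewrite ?reluZ// -scalemxAl -scalemxAr scalerA mulrC//.
Qed.

Lemma norm2_network d (W : forall i : 'I_d, 'M[R]_(n i.+1, n i)) x :
  (forall i v, norm2 (W i *m v) <= norm2 v) -> norm2 (network W x) <= norm2 x.
Proof.
elim: d W => [//|d IH] W hW; rewrite networkS; apply: (le_trans (hW ord_max _)).
have hz : norm2 (network (fun i => W (widen_ord (leqnSn d) i)) x) <= norm2 x.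
  by apply: IH => i v; exact: (hW (widen_ord _ i) v).
by case: ifP => // _; exact: le_trans (norm2_relu _) hz.
Qed.

(** Induction through V y - U y' = V (y - y') + (V - U) y'. Only [V] is assumed contractive; outputs
    of [U] are bounded by (1 + eps)^d |x| through the induction hypothesis, so each layer adds at
    most eps (1 + eps)^d |x| to the error. *)
Lemma norm2_network_sub d (V U : forall i : 'I_d, 'M[R]_(n i.+1, n i)) eps x :
  0 <= eps ->
  (forall i v, norm2 (V i *m v) <= norm2 v) ->
  (forall i v, norm2 ((V i - U i) *m v) <= eps * norm2 v) ->
  norm2 (network V x - network U x) <= ((1 + eps) ^+ d - 1) * norm2 x.
Proof.
move=> e0; elim: d V U => [|d IH] V U hV hVU.
  by rewrite subrr norm2_0 expr0 subrr mul0r.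
rewrite !networkS.
set z := network _ x; set z' := network _ x.
have hz : norm2 z <= norm2 x.
  by apply: norm2_network => i v; exact: (hV (widen_ord _ i) v).
have hzz : norm2 (z - z') <= ((1 + eps) ^+ d - 1) * norm2 x.
  by apply: IH => i v; [exact: (hV (widen_ord _ i) v)|exact: (hVU (widen_ord _ i) v)].
have hz' : norm2 z' <= (1 + eps) ^+ d * norm2 x.
  have -> : z' = - 1 *: (z - z') + z by rewrite scaleN1r opprB subrK.
  rewrite (le_trans (norm2D _ _))// norm2Z normrN1 mul1r; lra.
set y := if _ then z else _; set y' := if _ then z' else _.
have hyy : norm2 (y - y') <= ((1 + eps) ^+ d - 1) * norm2 x.
  by rewrite /y /y'; case: ifP => // _; exact: le_trans (norm2_relu_sub _ _) _.
have hy' : norm2 y' <= (1 + eps) ^+ d * norm2 x.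
  by rewrite /y'; case: ifP => // _; exact: le_trans (norm2_relu _) _.
have -> : V ord_max *m y - U ord_max *m y' =
    V ord_max *m (y - y') + (V ord_max - U ord_max) *m y'.
  by rewrite mulmxBr mulmxBl addrA subrK.
rewrite (le_trans (norm2D _ _))//.
have h1 := hV ord_max (y - y'); have h2 := hVU ord_max y'.
have h3 : eps * norm2 y' <= eps * ((1 + eps) ^+ d * norm2 x) by exact: ler_wpM2l.
rewrite exprS; lra.
Qed.

(** The smallness hypothesis bounds the quadratic term 2 d eps^2 of the induction step by eps. *)
Lemma expr1D_le d (eps : R) :
  0 <= eps -> 2 * d%:R * eps <= 1 -> (1 + eps) ^+ d <= 1 + 2 * d%:R * eps.
Proof.
move=> e0; elim: d => [|d IH] hd; first by rewrite expr0; lra.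
have hd' : 2 * d%:R * eps <= 1 by move: hd; rewrite -natr1; lra.
have {IH} := IH hd'; rewrite exprS -natr1 => IH.
have d0 : 0 <= d%:R :> R by [].
have : (1 + eps) * (1 + eps) ^+ d <= (1 + eps) * (1 + 2 * d%:R * eps).
  by rewrite ler_wpM2l//; lra.
have : (2 * d%:R * eps) * eps <= 1 * eps by rewrite ler_wpM2r.
lra.
Qed.

End network_perturbation.

(** * Margin events and their measurability *)

Section margin.
Variables (R : realType) (n k : nat) (B : R) (k_gt1 : (1 < k)%N).

(** A competing label [j] replaces the extended-real maximum, so later steps are linear inequalities
    between two output coordinates. *)
Lemma margin_violationP (f : 'cV[R]_n -> 'cV[R]_k) gamma
    (xy : input_ball n B * label k_gt1) :
  reflect (exists2 j : 'I_k, j != xy.2 & f (sval xy.1) (xy.2 : 'I_k) 0 <=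
                                  gamma + f (sval xy.1) j 0)
          (margin_violation f gamma xy).
Proof.
rewrite /margin_violation; set z := f _; set y : 'I_k := xy.2.
apply: (iffP idP) => [|[j jy zyj]]; last first.
  rewrite (le_trans (y := (gamma + z j 0)%:E))// ?lee_fin// EFinD leeD2l//.
  exact: (le_bigmax_cond _ (fun j => (z j 0)%:E)).
move=> H; apply: contrapT => nex.
have : (\big[maxe/-oo]_(j < k | j != y) (z j 0)%:E < (z y 0 - gamma)%:E)%E.
  apply: bigmax_lt => [|j jy]; first by rewrite ltNyr.
  by rewrite lte_fin ltrBrDl ltNge; apply/negP => h; apply: nex; exists j.
by rewrite EFinB lteBrDl// ltNge H.
Qed.

Lemma measurable_margin_violation (f : 'cV[R]_n -> 'cV[R]_k) gamma :
  (forall j, measurable_fun setT (fun x : input_ball n B => f (sval x) j 0)) ->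
  measurable [set xy : input_ball n B * label k_gt1 | margin_violation f gamma xy].
Proof.
move=> mf.
pose G y j := [set xy : input_ball n B * label k_gt1 |
   f (sval xy.1) y 0 <= gamma + f (sval xy.1) j 0].
rewrite (_ : mkset _ = \big[setU/set0]_(y < k)
   \big[setU/set0]_(j < k | j != y) (snd @^-1` [set y : label k_gt1] `&` G y j)).
  apply: bigsetU_measurable => y _; apply: bigsetU_measurable => j _.
  apply: measurableI.
    by rewrite -[X in measurable X]setTI; exact: measurable_snd.
  rewrite -[G y j]setTI; apply: measurable_fun_le => //.
    exact: (measurableT_comp (mf y) measurable_fst).
  apply: measurable_funD; first exact: measurable_cst.
  exact: (measurableT_comp (mf j) measurable_fst).
apply/seteqP; split => [xy /= /margin_violationP[j jy h]|xy].
  rewrite (bigD1 (xy.2 : 'I_k))//=; left; rewrite (bigD1 j)//=; left; split => //.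
move=> /= H; apply/margin_violationP; move: H.
apply: (big_ind (fun A : set _ => A xy -> _)) => // [A A' h h' []//|y _].
apply: (big_ind (fun A : set _ => A xy -> _)) => // [A A' h h' []//|j jy].
by move=> [/= ->]; exists j.
Qed.

End margin.

Lemma measurable_network (R : realType) (n : nat -> nat) (B : R) d
    (W : forall i : 'I_d, 'M[R]_(n i.+1, n i)) (j : 'I_(n d)) :
  measurable_fun setT (fun x : input_ball (n 0%N) B => network W (sval x) j 0).
Proof.
elim: d W j => [|d IH] W j.
  (* The sigma-algebra on the ball is generated by [ball_coords], hence its coordinates are
     measurable. *)
  rewrite (_ : (fun x => _) = (fun v => tnth v j) \o @ball_coords R (n 0%N) B).
    apply: measurableT_comp; first exact: measurable_tnth.
    by move=> _ Y mY; exists Y.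
  by apply/funext => x /=; rewrite tnth_mktuple.
rewrite (_ : (fun x => _) = fun x : input_ball (n 0%N) B => \sum_i W ord_max j i *
  (if d == 0%N then network (fun i => W (widen_ord (leqnSn d) i)) (sval x) i 0
  else Num.max (network (fun i => W (widen_ord (leqnSn d) i)) (sval x) i 0) 0)).
  apply: measurable_sum => i; apply: measurable_funM; first exact: measurable_cst.
  case: (d == 0%N); first exact: IH.
  by apply: measurable_maxr; [exact: IH|exact: measurable_cst].
apply/funext => x; rewrite networkS mxE; apply: eq_bigr => i _.
by case: ifP => // _; rewrite mxE.
Qed.

(** * Covering all layers by words of grid dyads *)

Definition grid_code (h : nat) : Type := {ffun 'I_h.+1 -> 'I_(16 * h).+1}.

HB.instance Definition _ h := Finite.on (grid_code h).

(** One code serves every dimension up to [h]: level l stands for l / (8 h) - 1, so the 16 h + 1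
    levels cover [-1, 1] with mesh 1 / (8 h). *)
Definition grid_vec (R : realType) (h n : nat) (u : grid_code h) : 'cV[R]_n :=
  \col_(i < n) ((u (inord i))%:R / (8 * h)%:R - 1).

Section cover.
Variables (R : realType) (h : nat).
Hypothesis h_gt0 : (0 < h)%N.

(** Rounding a coordinate down costs at most 1 / (8 h), and at most [h] such errors have Euclidean
    norm at most sqrt h / (8 h) <= 1 / 8. *)
Lemma grid_vec_approx n (x : 'cV[R]_n) :
  (n <= h)%N -> norm2 x <= 1 ->
  exists u : grid_code h, norm2 (grid_vec R n u - x) <= 8^-1.
Proof.
move=> nh x1.
have h8 : 0 < (8 * h)%:R :> R by rewrite ltr0n muln_gt0.
(* Coordinates from [n] on are padded with 0. *)
pose c (k : 'I_h.+1) : R := if insub (nat_of_ord k) is Some i then x i 0 else 0.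
pose u : grid_code h :=
  [ffun k => inord (Num.truncn ((8 * h)%:R * (c k + 1)))].
have xb i : -1 <= x i 0 <= 1.
  by rewrite -ler_norml (le_trans (norm2_coord _ _)).
have gE i : `|grid_vec R n u i 0 - x i 0| <= (8 * h)%:R^-1.
  rewrite mxE ffunE.
  have -> : c (inord i) = x i 0.
    by rewrite /c inordK ?valK// ltnS (leq_trans _ nh)// ltnW.
  have /andP[xl xr] := xb i.
  have y0 : 0 <= (8 * h)%:R * (x i 0 + 1) by rewrite mulr_ge0; lra.
  have [t1 t2] := andP (truncn_itv y0).
  rewrite inordK; last first.
    rewrite ltnS truncn_le_nat (@le_lt_trans _ _ (16 * h)%:R)// ?ltr_nat//.
    have -> : (16 * h)%:R = (8 * h)%:R * 2 :> R by rewrite -natrM mulnAC.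
    by rewrite ler_pM2l//; lra.
  move: t1 t2; set t : R := (Num.truncn _)%:R => t1 t2.
  have -> : t / (8 * h)%:R - 1 - x i 0 =
      (t - (8 * h)%:R * (x i 0 + 1)) / (8 * h)%:R.
    by rewrite mulrBl mulrAC divff ?mul1r ?gt_eqF//; ring.
  rewrite normrM normfV (gtr0_norm h8) -[leRHS]mul1r ler_pM2r ?invr_gt0//.
  rewrite ler_norml; move: t2; rewrite -natr1 -/t; lra.
exists u; apply: norm2_le => //.
apply: (@le_trans _ _ (\sum_(i < n) ((8 * h)%:R^-1) ^+ 2)).
  apply: ler_sum => i _.
  have -> : (grid_vec R n u - x) i 0 = grid_vec R n u i 0 - x i 0 by rewrite !mxE.
  rewrite -[leLHS]real_normK ?num_real//.
  by apply: lerXn2r; rewrite ?nnegrE ?invr_ge0// gE.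
rewrite sumr_const card_ord -[leLHS]mulr_natl (natrM _ 8 h) invfM exprMn mulrCA.
rewrite -[leRHS]mulr1.
rewrite ler_wpM2l ?sqr_ge0//.
have hR : 0 < h%:R :> R by rewrite ltr0n.
rewrite exprVn ler_pdivrMr ?exprn_gt0// mul1r (@le_trans _ _ h%:R) ?ler_nat//.
by rewrite -natrX ler_nat expnS expn1 leq_pmulr.
Qed.

(** Round a near-maximizer x and y = M x / |M x| to the grid. The inner product of y and M x is |M
    x| >= 7/8 |M|, and the two roundings lose at most 1/8 |M| and 9/64 |M|, leaving 39/64 |M| > eps
    / 2. *)
Lemma large_spectral_norm_witness a b (M : 'M[R]_(a, b)) (eps : R) :
  (a <= h)%N -> (b <= h)%N -> 0 < eps -> eps < spectral_norm M ->
  exists u v : grid_code h,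
    [/\ norm2 (grid_vec R a u) <= 9 / 8, norm2 (grid_vec R b v) <= 9 / 8 &
        eps / 2 <= \sum_i grid_vec R a u i 0 * (M *m grid_vec R b v) i 0].
Proof.
move=> ah bh e0 eM.
have [|x x1 Mx] := @spectral_norm_approx _ _ _ M (7 / 8 * spectral_norm M); first lra.
have Mx0 : 0 < norm2 (M *m x) by lra.
pose y := (norm2 (M *m x))^-1 *: (M *m x).
have y1 : norm2 y <= 1 by rewrite norm2Z normfV gtr0_norm// mulVf// gt_eqF.
have [u hu] := grid_vec_approx ah y1; have [v hv] := grid_vec_approx bh x1.
have near n (z g : 'cV[R]_n) : norm2 z <= 1 -> norm2 (g - z) <= 8^-1 -> norm2 g <= 9 / 8.
  by move=> z1 gz; have := norm2D (g - z) z; rewrite subrK; lra.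
exists u, v; split; [exact: near y1 hu|exact: near x1 hv|].
have gu := near _ _ _ y1 hu.
set gu' := grid_vec R a u in hu gu *; set gv := grid_vec R b v in hv *.
rewrite (eq_bigr (fun i => y i 0 * (M *m x) i 0
   - ((y - gu') i 0 * (M *m x) i 0 + gu' i 0 * (M *m (x - gv)) i 0))); last first.
  by move=> i _; rewrite mulmxBr !mxE; ring.
rewrite sumrB big_split/=.
have d1 := dot_le (y - gu') (M *m x).
have d2 := dot_le gu' (M *m (x - gv)).
have dy : \sum_i y i 0 * (M *m x) i 0 = norm2 (M *m x).
  rewrite /y; under eq_bigr do rewrite mxE -mulrA -expr2.
  by rewrite -mulr_sumr -sqr_norm2 expr2 mulrA mulVf ?mul1r// gt_eqF.
have nsym n (z g : 'cV[R]_n) : norm2 (z - g) = norm2 (g - z).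
  by rewrite -opprB -scaleN1r norm2Z normrN1 mul1r.
have M1 := norm2_mulmx_le M x; have M2 := norm2_mulmx_le M (x - gv).
move: d1 d2 M2; rewrite (nsym _ y) (nsym _ x) => d1 d2 M2.
have s0 : 0 <= spectral_norm M by exact: spectral_norm_ge0.
have b1 : norm2 (gu' - y) * norm2 (M *m x) <= 8^-1 * spectral_norm M.
  by apply: ler_pM; rewrite ?norm2_ge0// (le_trans M1)// ler_piMr.
have b2 : norm2 gu' * norm2 (M *m (x - gv)) <= 9 / 8 * (spectral_norm M * 8^-1).
  by apply: ler_pM; rewrite ?norm2_ge0// (le_trans M2)// ler_wpM2l.
lra.
Qed.

Lemma frobenius_sub_rank1 a b (M : 'M[R]_(a, b)) (x : 'cV[R]_a) (y : 'cV[R]_b) (c : R) :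
  frobenius_norm (M - c *: (x *m y^T)) ^+ 2 =
  frobenius_norm M ^+ 2 - 2 * c * (\sum_i x i 0 * (M *m y) i 0)
  + c ^+ 2 * (norm2 x ^+ 2 * norm2 y ^+ 2).
Proof.
rewrite !sqr_frobenius_norm !sqr_norm2 mulr_suml mulr_sumr mulr_sumr -sumrB -big_split/=.
apply: eq_bigr => i _; rewrite mxE !mulr_sumr -sumrB -big_split/=.
by apply: eq_bigr => j _; rewrite !mxE big_ord1 mxE; ring.
Qed.

Definition letter (d : nat) : Type := ('I_d * grid_code h * grid_code h)%type.

HB.instance Definition _ d := Finite.on (letter d).

Section words.
Variables (d : nat) (n : nat -> nat) (eps : R).
Hypothesis d_gt0 : (0 < d)%N.
Hypothesis n_le : forall i, (i <= d)%N -> (n i <= h)%N.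
Hypothesis eps_gt0 : 0 < eps.

(** The step size is the fixed [eps / 4], not the optimal coefficient, so a letter carries no real
    parameter and the alphabet is finite. *)
Definition letter_mx (l : letter d) (i : 'I_d) : 'M[R]_(n i.+1, n i) :=
  if l.1.1 == i then
    (eps / 4) *: (grid_vec R (n i.+1) l.1.2 *m (grid_vec R (n i) l.2)^T)
  else 0.

Definition word_mx (w : seq (letter d)) (i : 'I_d) : 'M[R]_(n i.+1, n i) :=
  \sum_(l <- w) letter_mx l i.

(* A layer farther than [eps] correlates with some grid dyad [u v^T], and
   subtracting [eps / 4] times that dyad decreases the squared Frobenius norm
   by at least [eps ^+ 2 / 8], so [T] steps suffice. *)
Lemma word_mx_approx T (V : forall i : 'I_d, 'M[R]_(n i.+1, n i)) :
  \sum_i frobenius_norm (V i) ^+ 2 <= T%:R * (eps ^+ 2 / 8) ->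
  exists w : T.-tuple (letter d),
    forall i x, norm2 ((V i - word_mx w i) *m x) <= eps * norm2 x.
Proof.
elim: T V => [|T IH] V hV.
  (* For length 0 the hypothesis forces every Frobenius norm to vanish. *)
  exists [tuple] => i x; rewrite /word_mx big_nil subr0.
  apply: (le_trans (norm2_mulmx_le _ _)); rewrite ler_wpM2r ?norm2_ge0//.
  apply: (le_trans (spectral_norm_le_frobenius _)).
  apply: (le_trans _ (ltW eps_gt0)).
  rewrite -(ler_pXn2r (n:=2))// ?nnegrE ?frobenius_norm_ge0// expr0n/=.
  apply: (le_trans _ (le_trans hV _)); last by rewrite mul0r.
  by rewrite (bigD1 i)//= lerDl sumr_ge0// => j _; exact: sqr_ge0.
case: (boolP [forall i, spectral_norm (V i) <= eps]) => [/forallP small|].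

  (* Level 8 h codes the coordinate 0, so letters built from [z] contribute nothing and pad the word
     to the exact length. *)
  pose z : grid_code h := [ffun => inord (8 * h)].
  have z0 k : grid_vec R k z = 0.
    apply/colP => i; rewrite !mxE ffunE inordK ?divff ?subrr//.
      by rewrite pnatr_eq0 -lt0n muln_gt0.
    by rewrite ltnS leq_mul2r orbT.
  exists [tuple of nseq T.+1 (Ordinal d_gt0, z, z)] => i x.
  rewrite /word_mx big1_seq; last first.
    move=> l /andP[_] /nseqP[-> _]; rewrite /letter_mx/= !z0 mul0mx scaler0.
    by case: ifP.
  by rewrite subr0 (le_trans (norm2_mulmx_le _ _))// ler_wpM2r ?norm2_ge0.
rewrite negb_forall => /existsP[i]; rewrite -ltNge => large.
have [u [v [gu gv uMv]]] := large_spectral_norm_witness (n_le (ltn_ord i))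
  (n_le (ltnW (ltn_ord i))) eps_gt0 large.
pose l : letter d := (i, u, v).
have [w hw] : exists w : T.-tuple (letter d), forall j x,
    norm2 ((V j - letter_mx l j - word_mx w j) *m x) <= eps * norm2 x.
  apply: (IH (fun j => V j - letter_mx l j)).
  apply: (@le_trans _ _ (\sum_i frobenius_norm (V i) ^+ 2 - eps ^+ 2 / 8)); last first.
    by move: hV; rewrite -natr1; lra.
  rewrite (bigD1 i)//= [X in _ <= X - _](bigD1 i)//= addrAC lerD//; last first.
    apply: ler_sum => j ji; rewrite /letter_mx/= eq_sym (negbTE ji) subr0//.
  rewrite /letter_mx/= eqxx frobenius_sub_rank1.
  (* The cross term gains at least eps^2 / 4, while the square of the dyad costs at most (eps / 4)^2
     (9/8)^4 < eps^2 / 8. *)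
  set s := \sum_i _ in uMv *.
  have gu2 : norm2 (grid_vec R (n i.+1) u) ^+ 2 <= (9 / 8) ^+ 2.
    by rewrite lerXn2r ?nnegrE ?norm2_ge0//; lra.
  have gv2 : norm2 (grid_vec R (n i) v) ^+ 2 <= (9 / 8) ^+ 2.
    by rewrite lerXn2r ?nnegrE ?norm2_ge0//; lra.
  have guv : norm2 (grid_vec R (n i.+1) u) ^+ 2 * norm2 (grid_vec R (n i) v) ^+ 2
      <= (9 / 8) ^+ 2 * (9 / 8) ^+ 2 by apply: ler_pM; rewrite ?sqr_ge0.
  have e2 : 0 <= (eps / 4) ^+ 2 by exact: sqr_ge0.
  have := ler_wpM2l e2 guv; have := ler_wpM2l (ltW eps_gt0) uMv.
  have := sqr_ge0 eps; lra.
exists [tuple of l :: w] => j x.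
by rewrite /word_mx big_cons opprD addrA.
Qed.

End words.

End cover.

(** * Union bound and size of the alphabet *)

(** The deviation [t i] varies with the index, so that longer words may be given larger
    deviations. *)
Lemma iid_uniform_tail (R : realType) (d d' : measure_display)
    (Omega : measurableType d) (T : measurableType d') (P : probability Omega R)
    (D : probability T R) (m : nat) (S : 'I_m -> {RV P >-> T}) (I : finType)
    (A : I -> set T) (t : I -> R) (delta : R) :
  iid D S -> (forall i, measurable (A i)) -> (0 < m)%N -> (forall i, 0 <= t i) ->
  \sum_i expR (- (m%:R * t i ^+ 2 / 4)) <= delta ->
  exists E : set Omega,
    [/\ measurable E, ((1 - delta)%:E <= P E)%E &
        forall w, E w -> forall i,
          fine (D (A i)) <=
            (\sum_(l < m) (`[< A i (S l w) >] : nat))%:R / m%:R + t i].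
Proof.
move=> Siid mA m0 t0 sumt.
have /choice[Bad hBad] := fun i => iid_lower_tail Siid (mA i) m0 (t0 i).
have mBad i : measurable (Bad i) by have [] := hBad i.
pose U := \big[setU/set0]_i Bad i.
have mU : measurable U by exact: bigsetU_measurable.
exists (~` U); split; first exact: measurableC.
  rewrite probability_setC// EFinB leeB// (le_trans (probability_bigsetU_le _ _ _ _))//.
  apply: (@le_trans _ _ (\sum_i (expR (- (m%:R * t i ^+ 2 / 4)))%:E)%E).
    by apply: lee_sum => i _; have [] := hBad i.
  by rewrite sumEFin lee_fin.
move=> w nUw i; have [_ _] := hBad i; apply => Biw; apply: nUw.
by rewrite /U (bigD1 i)//=; left.
Qed.

(** As h >= 2, 16 h + 1 <= 32 h <= h^6 and h + 1 <= 2 h, so there are at most h^(12 h) grid codes; a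
    letter uses two of them. *)
Lemma card_letter_le (d h : nat) :
  (0 < d)%N -> (1 < h)%N -> (#|{: letter h d}| <= (d * h) ^ (24 * h))%N.
Proof.
move=> d0 h1; rewrite !card_prod card_ffun !card_ord -mulnA.
have h0 : (0 < h)%N by exact: ltnW.
have code : ((16 * h).+1 ^ h.+1 <= h ^ (12 * h))%N.
  apply: (@leq_trans ((16 * h).+1 ^ (2 * h))).
    by apply: leq_pexp2l => //; lia.
  rewrite (_ : 12 * h = 6 * (2 * h))%N; last by rewrite mulnA.
  rewrite (expnM h 6) leq_exp2r ?muln_gt0//.
  rewrite expnSr (@leq_trans (32 * h))//; last first.
    by rewrite leq_mul2r orbC (leq_exp2r 2 h (e := 5)) ?h1.
  lia.
rewrite expnMn leq_mul//; first by rewrite -{1}(expn1 d) leq_pexp2l// muln_gt0.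
rewrite (_ : 24 * h = 12 * h + 12 * h)%N; last lia.
by rewrite expnD leq_mul.
Qed.

(** Used to see that h ln (d h) >= 1 when h >= 2. *)
Lemma ge_half_ln2 (R : realType) : 2^-1 <= ln 2 :> R.
Proof.
rewrite -ler_expR lnK ?posrE//.
have := expR_ge1Dx (- 2^-1 : R); rewrite expRN.
have e0 := @expR_gt0 R 2^-1 => h.
have : 2^-1 <= (expR (2^-1 : R))^-1 by apply: le_trans h; lra.
by rewrite lef_pV2 ?posrE.
Qed.

(** * Transfer of margins between a network and its word *)

Section network_cover.
Variables (R : realType) (h d : nat) (n : nat -> nat) (B : R).
Variables (k_gt1 : (1 < n d)%N) (W : forall i : 'I_d, 'M[R]_(n i.+1, n i)).
Hypotheses (d_gt0 : (0 < d)%N) (W_neq0 : forall i, W i != 0) (B_gt0 : 0 < B).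

Let s := \prod_(i < d) spectral_norm (W i).
Let V i := (spectral_norm (W i))^-1 *: W i.

Let s_gt0 : 0 < s.
Proof. by apply: prodr_gt0 => i _; exact: spectral_norm_gt0. Qed.

Let network_unit x : network W x = s *: network V x.
Proof.
rewrite network_scale => [|i]; last by rewrite invr_ge0 spectral_norm_ge0.
by rewrite scalerA prodfV divff ?scale1r// gt_eqF.
Qed.

Let unit_contract i v : norm2 (V i *m v) <= norm2 v.
Proof.
have s0 := spectral_norm_gt0 (W_neq0 i).
rewrite -scalemxAl norm2Z normfV gtr0_norm// mulrC ler_pdivrMr// mulrC.
exact: norm2_mulmx_le.
Qed.

Let input_le (x : input_ball (n 0%N) B) : norm2 (sval x) <= B.
Proof. by apply: norm2_le; [exact: ltW|exact: (svalP x)]. Qed.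

(** Outputs have norm at most s B, so two coordinates differ by at most 2 s B; a competing label
    exists because there are two labels or more. *)
Lemma margin_violation_wide gamma (xy : input_ball (n 0%N) B * label k_gt1) :
  2 * s * B <= gamma -> margin_violation (network W) gamma xy.
Proof.
move=> sB; apply/margin_violationP.
have [j jy] : exists j : 'I_(n d), j != xy.2.
  have [y0|y0] := eqVneq (val (xy.2 : 'I_(n d))) 0%N.
    by exists (Ordinal k_gt1); rewrite -val_eqE/= y0.
  by exists (Ordinal (ltnW k_gt1)); rewrite -val_eqE/= eq_sym.
exists j => //; rewrite network_unit !mxE.
have := norm2_network (sval xy.1) unit_contract.
have := input_le xy.1.
set v := network V _ => xB vx.
have := norm2_coord v (xy.2 : 'I_(n d)); have := norm2_coord v j.
rewrite !ler_norml => /andP[a1 a2] /andP[b1 b2].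
have : s * (v (xy.2 : 'I_(n d)) 0 - v j 0) <= s * (2 * B).
  by rewrite ler_wpM2l ?(ltW s_gt0)//; lra.
lra.
Qed.

(** With eps = 1 / q, each output of the normalized network is within a = 2 d B / q of the word's.
    Comparing two coordinates costs 2 a = [tau] in each direction, and s (4 a) <= gamma by the
    choice of [q]. The threshold [tau] does not depend on [W], so the event of [f] belongs to a
    finite family. *)
Lemma word_margin_sandwich gamma (q T : nat) :
  (0 < h)%N -> (forall i, (i <= d)%N -> (n i <= h)%N) -> 0 < gamma ->
  (0 < q)%N -> 2 * d%:R <= q%:R :> R -> 8 * d%:R * B * s / gamma <= q%:R ->
  8 * q%:R ^+ 2 * (\sum_i frobenius_norm (W i) ^+ 2 / spectral_norm (W i) ^+ 2)
    <= T%:R ->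
  exists w : T.-tuple (letter h d),
    forall xy : input_ball (n 0%N) B * label k_gt1,
      let f := network (word_mx n q%:R^-1 w) in
      let tau := 4 * d%:R * B / q%:R in
      (margin_violation (network W) 0 xy -> margin_violation f tau xy) /\
      (margin_violation f tau xy -> margin_violation (network W) gamma xy).
Proof.
move=> h0 nh g0 q0 qd qs qT.
have qR : 0 < q%:R :> R by rewrite ltr0n.
have e0 : 0 < q%:R^-1 :> R by rewrite invr_gt0.
have [|w hw] := @word_mx_approx R h h0 d n q%:R^-1 d_gt0 nh e0 T V.
  rewrite (eq_bigr (fun i => frobenius_norm (W i) ^+ 2 / spectral_norm (W i) ^+ 2)).
    rewrite exprVn -invfM ler_pdivlMr ?mulr_gt0 ?exprn_gt0//; lra.
  move=> i _; rewrite !sqr_frobenius_norm mulr_suml; apply: eq_bigr => a _.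
  rewrite mulr_suml; apply: eq_bigr => b _.
  by rewrite mxE exprMn exprVn mulrC.
exists w => xy f tau.
pose a : R := 2 * d%:R * B / q%:R.
have tauE : tau = 2 * a by rewrite /tau /a; lra.
set x := sval xy.1.
have fV j : `|network V x j 0 - f x j 0| <= a.
  have -> : network V x j 0 - f x j 0 = (network V x - f x) j 0 by rewrite !mxE.
  apply: (le_trans (norm2_coord _ _)).
  apply: (le_trans (norm2_network_sub _ (ltW e0) unit_contract hw)).
  have de : 2 * d%:R * q%:R^-1 <= 1 :> R by rewrite ler_pdivrMr// mul1r.
  have p1 := expr1D_le (ltW e0) de.
  have -> : a = (2 * d%:R * q%:R^-1) * B by rewrite /a; ring.
  apply: ler_pM; rewrite ?norm2_ge0 ?input_le//; last lra.
  by rewrite subr_ge0 exprn_ege1// lerDl ltW.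
have a4 : s * (4 * a) <= gamma.
  have -> : s * (4 * a) = 8 * d%:R * B * s / q%:R by rewrite /a; ring.
  by rewrite ler_pdivrMr// [leRHS]mulrC -ler_pdivrMr.
split=> /margin_violationP[j jy]; rewrite -/x => H; apply/margin_violationP;
  exists j => //; rewrite -/x; have := fV j; have := fV (xy.2 : 'I_(n d));
  rewrite !ler_norml => /andP[a1 a2] /andP[b1 b2].
- move: H; rewrite network_unit !mxE add0r ler_pM2l// tauE; lra.
- rewrite network_unit !mxE.
  have : s * (network V x (xy.2 : 'I_(n d)) 0 - network V x j 0) <= s * (4 * a).
    by rewrite ler_wpM2l ?(ltW s_gt0)//; move: H; rewrite tauE; lra.
  lra.
Qed.

End network_cover.

(** * Weights of the words and choice of the discretization *)

(** Each of the m^2 pairs (q, T) receives delta / m^2, shared equally by the #|L|^T words of length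
    T; ordinals are shifted by one so that T runs from 1 to m. *)
Lemma sum_word_weights (R : realType) (L : finType) (m : nat) (delta : R) :
  (0 < #|L|)%N -> (0 < m)%N -> 0 < delta ->
  \sum_(i : {p : 'I_m * 'I_m & (p.2.+1).-tuple L})
     expR (- ((tag i).2.+1%:R * ln #|L|%:R + ln (m%:R ^+ 2 / delta))) = delta.
Proof.
move=> L0 m0 de0.
have LR : 0 < #|L|%:R :> R by rewrite ltr0n.
have mR : 0 < m%:R :> R by rewrite ltr0n.
rewrite -(sig_big_dep (fun _ => true) (fun _ _ => true)
  (fun (p : 'I_m * 'I_m) (_ : (p.2.+1).-tuple L) =>
     expR (- (p.2.+1%:R * ln #|L|%:R + ln (m%:R ^+ 2 / delta)))))/=.
rewrite (eq_bigr (fun=> delta / m%:R ^+ 2)) => [|p _].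
  rewrite sumr_const card_prod card_ord -[LHS]mulr_natl natrM -expr2.
  by rewrite mulrC divfK// gt_eqF ?exprn_gt0.
rewrite sumr_const card_tuple -[LHS]mulr_natl opprD expRD -lnV ?posrE; last first.
  by rewrite divr_gt0 ?exprn_gt0.
rewrite lnK ?posrE ?invr_gt0 ?divr_gt0 ?exprn_gt0// invf_div.
rewrite expRN expRM_natl lnK ?posrE// natrX mulrA divff ?mul1r//.
by rewrite gt_eqF ?exprn_gt0.
Qed.

(** Put kap = d B s / gamma, so kap > d / 2 by the last hypothesis. Rounding up costs a factor 2 in
    q <= 16 kap, then 8 q^2 Phi <= 2048 kap^2 Phi, and the final unit is absorbed by 256 kap^2
    Phi. *)
Lemma word_length_le (R : realType) (d : nat) (B s gamma Phi : R) :
  (0 < d)%N -> 0 < B -> 0 < s -> 0 < gamma -> 1 <= Phi ->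
  gamma < 2 * s * B ->
  exists q T : nat,
    [/\ (0 < q <= T)%N, 2 * d%:R <= q%:R :> R,
        8 * d%:R * B * s / gamma <= q%:R, 8 * q%:R ^+ 2 * Phi <= T%:R &
        T%:R <= 2304 * (d%:R * B * s / gamma) ^+ 2 * Phi].
Proof.
move=> d0 B0 s0 g0 Phi1 gsB.
have dR : 1 <= d%:R :> R by rewrite ler1n.
pose kap := d%:R * B * s / gamma.
have kapd : d%:R < 2 * kap.
  rewrite /kap -!mulrA mulrCA ltr_pMr ?ltr0n// !mulrA ltr_pdivlMr// mul1r.
  by rewrite mulrAC.
have ->  : 8 * d%:R * B * s / gamma = 8 * kap by rewrite /kap; ring.
pose q := (Num.truncn (8 * kap)).+1.
have qgt : 8 * kap < q%:R by exact: truncnS_gt.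
have qle : q%:R <= 16 * kap.
  rewrite /q -natr1; have : (Num.truncn (8 * kap))%:R <= 8 * kap.
    by rewrite truncn_le; lra.
  lra.
have q1 : 1 <= q%:R :> R by rewrite ler1n.
have q2 : q%:R ^+ 2 <= (16 * kap) ^+ 2 by rewrite lerXn2r ?nnegrE//; lra.
have q21 : q%:R <= q%:R ^+ 2 :> R by rewrite expr2 ler_peMr//; lra.
pose x := q%:R ^+ 2 * Phi.
have xq : q%:R ^+ 2 <= x by rewrite ler_peMr// sqr_ge0.
have xk : x <= (16 * kap) ^+ 2 * Phi by rewrite ler_wpM2r//; lra.
pose T := (Num.truncn (8 * x)).+1.
have Tgt : 8 * x < T%:R by exact: truncnS_gt.
have Tle : T%:R <= 8 * x + 1.
  by rewrite /T -natr1 lerD2r truncn_le; lra.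
exists q, T; split => //.
- by rewrite -(ler_nat R q) /=; lra.
- lra.
- exact: ltW.
- by rewrite -mulrA -/x; lra.
- by move: xk; rewrite -/kap exprMn; lra.
Qed.

(** * Assembly of the generalization bound from cover and concentration *)

Theorem theorem1 (R : realType) :
  exists2 C : R, 0 < C &
  forall (B : R) (d h : nat) (n : nat -> nat) (k_gt1 : (1 < n d)%N)
    (D : probability (input_ball (n 0%N) B * label k_gt1)%type R)
    (delta gamma : R) (m : nat)
    (dO : measure_display) (Omega : measurableType dO)
    (P : probability Omega R)
    (S : 'I_m -> {RV P >-> (input_ball (n 0%N) B * label k_gt1)%type}),
  0 < B -> (1 <= d)%N -> (1 <= h)%N ->
  (forall i : nat, (i <= d)%N -> (0 < n i <= h)%N) ->
  0 < delta -> 0 < gamma -> (1 <= m)%N ->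
  iid D S ->
  exists E : set Omega,
    [/\ measurable E,
        ((1 - delta)%:E <= P E)%E &
        forall omega : Omega, E omega ->
        forall W : (forall i : 'I_d, 'M[R]_(n i.+1, n i)),
        (forall i, W i != 0) ->
        margin_loss D 0 (network W) <=
          empirical_margin_loss (fun i => S i omega) gamma (network W)
          + C * Num.sqrt
              ((1 / gamma ^+ 2 * B ^+ 2 * d%:R ^+ 2 * h%:R * ln (d * h)%:R
                * (\prod_(i < d) spectral_norm (W i) ^+ 2)
                * (\sum_(i < d)
                     frobenius_norm (W i) ^+ 2 / spectral_norm (W i) ^+ 2)
                + ln ((d * m)%:R / delta)) / m%:R)].
Proof.
(* The constant is 2 * 500: the deviation is 2 sqrt (X / m), and X is shown to be at most 500^2 Y
   m. *)
exists 1000; first by rewrite ltr0n.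
move=> B d h n k_gt1 D delta gamma m dO Omega P S B0 d0 h0 nh de0 g0 m0 Siid.
have h1 : (1 < h)%N.
  by have /andP[_] := nh d (leqnn d); exact: leq_trans.
(* For delta >= 1 the empty event suffices; otherwise the logarithms below are nonnegative. *)
have [de1|de1] := leP 1 delta.
  by exists set0; split => //; rewrite measure0 lee_fin subr_le0.
have mR : 0 < m%:R :> R by rewrite ltr0n.
have m1 : 1 <= m%:R :> R by rewrite ler1n.
have dR : 1 <= d%:R :> R by rewrite ler1n.
pose L := letter h d.
have L0 : (0 < #|{: L}|)%N.
  by apply/card_gt0P; exists (Ordinal d0, [ffun=> ord0], [ffun=> ord0]).
(* The tag stores (q - 1, T - 1): inverse accuracy [q] and length [T], both from 1 to m. *)
pose word := {p : 'I_m * 'I_m & (p.2.+1).-tuple L}.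
pose f (w : word) := network (word_mx (R := R) n (tag w).1.+1%:R^-1 (tagged w)).
pose tau (w : word) : R := 4 * d%:R * B / (tag w).1.+1%:R.
pose A (w : word) :=
  [set xy : input_ball (n 0%N) B * label k_gt1 | margin_violation (f w) (tau w) xy].
(* [X T] is minus the log of a word's weight, and [t] solves m t^2 / 4 = X. *)
pose X T : R := T%:R * ln #|{: L}|%:R + ln (m%:R ^+ 2 / delta).
pose t (w : word) : R := 2 * Num.sqrt (X (tag w).2.+1 / m%:R).
have lnL0 : 0 <= ln #|{: L}|%:R :> R by rewrite ln_ge0// ler1n.
have lnm0 : 0 <= ln (m%:R ^+ 2 / delta).
  by rewrite ln_ge0// ler_pdivlMr// mul1r (le_trans (ltW de1))// exprn_ege1.
have X0 T : 0 <= X T by rewrite addr_ge0// mulr_ge0.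
have mf (W : forall i : 'I_d, 'M[R]_(n i.+1, n i)) c :
    measurable [set xy : input_ball (n 0%N) B * label k_gt1 |
      margin_violation (network W) c xy].
  by apply: measurable_margin_violation => j; exact: measurable_network.
have mA w : measurable (A w) by exact: mf.
have [||E [mE PE hE]] :=
    iid_uniform_tail (A := A) (t := t) (delta := delta) Siid mA m0.
- by move=> w; rewrite mulr_ge0// sqrtr_ge0.
- rewrite -[leRHS](sum_word_weights L0 m0 de0) ler_sum// => w _.
  rewrite ler_expR lerN2 /t exprMn sqr_sqrtr ?divr_ge0//.
  by rewrite le_eqVlt; apply/orP; left; apply/eqP; rewrite -/(X _); field; rewrite gt_eqF.
exists E; split => // om Eom W W0.
set Phi := \sum_(i < d) _.
set s2 := \prod_(i < d) _.
set K := _ * s2 * Phi.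
set Y := (_ / m%:R).
pose s := \prod_(i < d) spectral_norm (W i).
have s0 : 0 < s by apply: prodr_gt0 => i _; exact: spectral_norm_gt0 (W0 i).
have s2E : s2 = s ^+ 2 by rewrite /s2 prodrXl.
have emp0 : 0 <= empirical_margin_loss (fun i => S i om) gamma (network W).
  by rewrite divr_ge0.
have loss1 : margin_loss D 0 (network W) <= 1.
  rewrite -lee_fin fineK ?probability_le1 ?fin_num_measure//; exact: mf.
have Y0 : 0 <= Num.sqrt Y by exact: sqrtr_ge0.
(* Two easy cases: the bound exceeds any probability, or gamma is so large that the empirical loss
   is 1. *)
have [triv|sY] := leP 1 (1000 * Num.sqrt Y); first lra.
have [wide|narrow] := leP (2 * s * B) gamma.
  rewrite (_ : empirical_margin_loss _ _ _ = 1); first lra.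
  rewrite /empirical_margin_loss (eq_bigr (fun=> 1%N)) => [|i _].
    by rewrite sum_nat_const card_ord muln1 divff// gt_eqF.
  by rewrite margin_violation_wide.
have Phi1 : 1 <= Phi.
  rewrite /Phi (bigD1 (Ordinal d0))//= -[leLHS]addr0 lerD//.
    rewrite ler_pdivlMr; last by rewrite exprn_gt0 ?(spectral_norm_gt0 (W0 (Ordinal d0))).
    rewrite mul1r.
    by rewrite lerXn2r ?nnegrE ?spectral_norm_ge0 ?frobenius_norm_ge0//
      spectral_norm_le_frobenius.
  by rewrite sumr_ge0// => i _; rewrite divr_ge0 ?sqr_ge0.
have [q [T [/andP[q0 qT] qd qs TPhi Tle]]] :=
  word_length_le d0 B0 s0 g0 Phi1 narrow.
(* Up to constants, [Q] bounds the word length and [H] the log of the alphabet size; their product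
   is [K]. *)
pose Q := (d%:R * B * s / gamma) ^+ 2 * Phi.
have Q0 : 0 <= Q by rewrite mulr_ge0 ?sqr_ge0//; lra.
pose H : R := h%:R * ln (d * h)%:R.
have H1 : 1 <= H.
  have h2 : 2 <= h%:R :> R by rewrite (ler_nat R 2).
  have : ln 2 <= ln (d * h)%:R :> R.
    by rewrite ler_ln ?posrE ?ltr0n ?muln_gt0 ?d0// (ler_nat R 2)
      (leq_trans h1)// leq_pmull.
  have := ge_half_ln2 R; rewrite /H; nra.
have KE : K = Q * H.
  by rewrite /K /Q /H s2E; field; rewrite gt_eqF.
have QK : Q <= K by rewrite KE ler_peMr.
have lndm : 0 <= ln ((d * m)%:R / delta).
  rewrite ln_ge0// ler_pdivlMr// mul1r (le_trans (ltW de1))//.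
  by rewrite ler1n muln_gt0 d0.
(* As delta < 1 <= d, m^2 / delta is at most (d m / delta)^2. *)
have lnmm : ln (m%:R ^+ 2 / delta) <= 2 * ln ((d * m)%:R / delta).
  have dmde : 0 < (d * m)%:R / delta by rewrite divr_gt0// ltr0n muln_gt0 d0.
  rewrite mulr_natl -lnXn// ler_ln ?posrE ?exprn_gt0// ?divr_gt0 ?exprn_gt0//.
  rewrite natrM (_ : (_ / delta) ^+ 2 = (m%:R ^+ 2 / delta) * (d%:R ^+ 2 / delta)).
    have : 1 <= d%:R ^+ 2 / delta.
      by rewrite ler_pdivlMr// mul1r (le_trans (ltW de1))// exprn_ege1.
    by apply: ler_peMr; rewrite divr_ge0 ?sqr_ge0// ltW.
  by field; rewrite gt_eqF.
have Ym : Y * m%:R = K + ln ((d * m)%:R / delta) by rewrite /Y divfK// gt_eqF.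
have Yge0 : 0 <= Y by rewrite /Y divr_ge0// addr_ge0//; lra.
have Ysmall : 10 ^+ 6 * Y < 1.
  rewrite -(sqr_sqrtr Yge0); nra.
(* Since the bound is below 1, q <= T <= m, so the pair (q, T) is covered by the union bound. *)
have Tm : (T <= m)%N.
  rewrite -(ler_nat R).
  have : 10 ^+ 6 * Y * m%:R < 1 * m%:R by rewrite ltr_pM2r.
  have : 2304 * Q <= 10 ^+ 6 * (Y * m%:R) by rewrite Ym; lra.
  move: Tle; rewrite -mulrA -/Q; lra.
have T0 : (0 < T)%N by exact: leq_trans qT.
have qm : (q.-1 < m)%N by rewrite prednK// (leq_trans qT).
have Tm' : (T.-1 < m)%N by rewrite prednK.
move: qd qs TPhi; rewrite -{1 2 3}(prednK q0) -{1}(prednK T0) => qd qs TPhi.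
have [|w hw] := word_margin_sandwich k_gt1 d0 W0 B0 (ltnW h1) _ g0 (ltn0Sn _) qd qs TPhi.
- by move=> i /nh/andP[].
pose i : word := Tagged (fun p : 'I_m * 'I_m => (p.2.+1).-tuple L)
  (i := (Ordinal qm, Ordinal Tm')) w.
have {}hw := hw : forall xy, (margin_violation (network W) 0 xy -> A i xy) /\
  (A i xy -> margin_violation (network W) gamma xy).
(* The true loss is at most the probability of [A i], which is at most its sample frequency plus
   [t i]; that frequency is at most the empirical loss at margin gamma. *)
apply: (@le_trans _ _ (fine (D (A i)))).
  apply: fine_le; [exact: fin_num_measure (mf _ _)|exact: fin_num_measure (mA i)|].
  apply: le_measure; rewrite ?inE; [exact: mf|exact: mA|].
  by move=> xy /= Hxy; exact: (hw xy).1.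
apply: (le_trans (hE _ Eom i)); apply: lerD.
  rewrite ler_wpM2r ?invr_ge0// ler_nat leq_sum// => l _.
  case: asboolP => // Ai; suff -> : margin_violation (network W) gamma (S l om) by [].
  exact: (hw _).2.
rewrite /t /= prednK//.
have lnLH : ln #|{: L}|%:R <= 24 * H.
  have dh0 : (0 < d * h)%N by rewrite muln_gt0 d0.
  apply: (@le_trans _ _ (ln ((d * h)%:R ^+ (24 * h)))).
    by rewrite ler_ln ?posrE ?exprn_gt0 ?ltr0n// -natrX ler_nat card_letter_le.
  by rewrite lnXn ?ltr0n// -[leLHS]mulr_natl natrM -mulrA.
(* The factor of [K] is 2304 * 24 = 55296, below 250 * 240. *)
have XT : X T <= 250 * (240 * (Y * m%:R)).
  have : T%:R * ln #|{: L}|%:R <= 2304 * Q * (24 * H).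
    by apply: ler_pM => //; rewrite /Q mulrA.
  have -> : 2304 * Q * (24 * H) = 2304 * 24 * K by rewrite KE; ring.
  have : 0 <= K by exact: le_trans QK.
  rewrite /X Ym; lra.
have : Num.sqrt (X T / m%:R) <= Num.sqrt (500 ^+ 2 * Y).
  by rewrite ler_wsqrtr// ler_pdivrMr// -mulrA (le_trans XT)//; lra.
have -> : Num.sqrt (500 ^+ 2 * Y) = 500 * Num.sqrt Y.
  by rewrite sqrtrM ?sqr_ge0// sqrtr_sqr ger0_norm.
lra.
Qed.
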